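(* Suppose $I\subseteq\mathbb{R}\langle x,x^*\rangle$ is the left ideal generated by a polynomial $p$ with $\deg(p)=1$. Then $I$ is real if and only if $p$ is not of the form $a-a^*+c$, where $a$ is analytic and homogeneous of degree $1$ and $c\neq 0$ is a real constant.
   Context: $\mathbb{R}\langle x,x^*\rangle$ is the free unital associative $\mathbb{R}$-algebra on the $2g$ noncommuting letters $x_1,\dots,x_g,x_1^*,\dots,x_g^*$, with the $\mathbb{R}$-linear involution $*$ that exchanges $x_i$ and $x_i^*$ and reverses products. The degree of a polynomial is the length of its longest word; a polynomial is homogeneous if all its words have the same length, and analytic if it contains none of the letters $x_i^*$. For a left ideal $I$, $I^*=\{a^*: a\in I\}$; $I$ is real if whenever $a_1,\dots,a_r\in\mathbb{R}\langle x,x^*\rangle$ satisfy $\sum_{i=1}^r a_i^*a_i\in I+I^*$, then $a_1,\dots,a_r\in I$. *)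

(* Defs.v *)
From mathcomp Require Import all_boot all_order all_algebra.
From mathcomp Require Import classical_sets reals.
From mathcomp.finmap Require Import finmap.
From mathcomp.multinomials Require Export monalg.

Set Implicit Arguments.
Unset Strict Implicit.
Unset Printing Implicit Defensive.

Import GRing.Theory Num.Theory.

Local Open Scope classical_set_scope.
Local Open Scope ring_scope.

(* [inl i] is the letter x_i and [inr i] is the letter x_i^*. *)
Notation letter g := ('I_g + 'I_g)%type.

Definition letter_star (g : nat) (l : letter g) : letter g :=
  match l with inl i => inr i | inr i => inl i end.

Notation word g := {fmonom (letter g)}.

Definition word_star (g : nat) (w : word g) : word g :=
  FMonom (rev (map (@letter_star g) w)).

(* The free unital associative algebra is the algebra of the free monoid. *)
Notation ncpoly R g := {malg R[word g]}.

Section NCPoly.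
Variables (R : realType) (g : nat).
Implicit Types (p : ncpoly R g) (I J : set (ncpoly R g)).

Definition star p : ncpoly R g :=
  \sum_(w <- msupp p) << p@_w *g word_star w >>.

(* The zero polynomial is given degree 0. *)
Definition degree p : nat := (\max_(w <- msupp p) fdeg w)%N.

Definition homogeneous p : Prop :=
  forall u v, u \in msupp p -> v \in msupp p -> fdeg u = fdeg v.

Definition analytic p : Prop :=
  forall w, w \in msupp p ->
  forall i : 'I_g, (inr i : letter g) \notin (w : seq (letter g)).

Definition left_ideal_gen p : set (ncpoly R g) := [set q * p | q in setT].

Definition star_set I : set (ncpoly R g) := [set star a | a in I].

Definition sum_set I J : set (ncpoly R g) := [set a + b | a in I & b in J].

Definition real_ideal I : Prop :=
  forall (r : nat) (a : 'I_r -> ncpoly R g),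
    sum_set I (star_set I) (\sum_(i < r) star (a i) * a i) ->
    forall i, I (a i).

End NCPoly.

(* Main.v *)
(** Write [p] as an affine polynomial with a nonzero coefficient at the letter
    [y]. If [p = a - star a + c] with [c != 0], then [p + star p = 2 c], so a
    real ideal would contain a nonzero constant, while nonzero multiples of [p]
    are not constant.
    Conversely, suppose that [F = \sum_i star (a i) * a i] is
    [b * p + star p * c]. Subtracting multiples of [p], no word of top length
    [n + 1] in [a i] ends in [y]; and [b], [c] may be taken of degree less than
    that of [F]. For letters [z1], [z2] and a word [w] of length [n], the
    coefficient of [F] at [star (w z1) w z2] is then [X z1 * p z2 + p z1 * Y z2],
    which vanishes if [z1 = y] or [z2 = y]; this forces it to vanish for all
    [z1 = z2], where it is the sum of the squares of the coefficients of the
    [a i] at [w z1]. So the degree drops, down to the case of constants. There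
    [b] and [c] are constants too, and [(b + c) * (p z + p (star z)) = 0], so
    that [F = (b + c) * p 1] is zero unless [p] has the excluded form. *)
Require Import Defs.
From mathcomp Require Import all_boot all_order all_algebra.
From mathcomp Require Import classical_sets reals.
From mathcomp.finmap Require Import finmap.
From mathcomp Require Import ring.

Set Implicit Arguments.
Unset Strict Implicit.
Unset Printing Implicit Defensive.

Import GRing.Theory Num.Theory.

Local Open Scope ring_scope.

Section Coefficients.
Variables (R : realType) (g : nat).
Implicit Types (f h p : ncpoly R g) (s t u v : seq (letter g)).

(** * Coefficients indexed by plain sequences, and the product formula *)

Definition cf f s : R := f@_(FMonom s).

Lemma cfP f h : cf f =1 cf h -> f = h.
Proof. by move=> e; apply/malgP => -[s]; apply: e. Qed.

Lemma cf0 s : cf 0 s = 0.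
Proof. exact: mcoeff0. Qed.

Lemma cfD f h s : cf (f + h) s = cf f s + cf h s.
Proof. exact: mcoeffD. Qed.

Lemma cfB f h s : cf (f - h) s = cf f s - cf h s.
Proof. exact: mcoeffB. Qed.

Lemma cfN f s : cf (- f) s = - cf f s.
Proof. exact: mcoeffN. Qed.

Lemma cfZ (k : R) f s : cf (k *: f) s = k * cf f s.
Proof. exact: mcoeffZ. Qed.

Lemma cf_sum (I : Type) (r : seq I) (P : pred I) (F : I -> ncpoly R g) s :
  cf (\sum_(i <- r | P i) F i) s = \sum_(i <- r | P i) cf (F i) s.
Proof. exact: raddf_sum. Qed.

Lemma cfC (k : R) s : cf k%:MP s = k *+ (s == [::]).
Proof. by rewrite /cf mcoeffC -[FMonom s == _]val_eqE /= fm1. Qed.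

Lemma mem_msupp f (w : word g) : (w \in msupp f) = (cf f w != 0).
Proof. by rewrite -mcoeff_neq0; case: w. Qed.

Lemma cf_fsetE (D : {fset word g}) (E : word g -> R) s :
  cf [malg w in D => E w] s = if FMonom s \in D then E (FMonom s) else 0.
Proof. exact: mcoeffE. Qed.

(** A concatenation equal to [s] matches exactly one cut of [s]. In [cfM] this turns a double sum
    over supports into a sum over cuts. *)
Lemma cat_eq_sum u v s :
  (u ++ v == s) =
    (\sum_(i < (size s).+1) ((u == take i s) && (v == drop i s)))%N :> nat.
Proof.
case: eqP => [<-|ne].
  have lt : (size u < (size (u ++ v)).+1)%N by rewrite size_cat ltnS leq_addr.
  rewrite (bigD1 (Ordinal lt)) //= take_size_cat // drop_size_cat // !eqxx.
  rewrite big1 // => i /eqP ni; apply/eqP; rewrite eqb0; apply/negP.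
  case/andP => /eqP eu _; apply: ni; apply: val_inj => /=.
  by have := congr1 size eu; rewrite size_takel ?(ltnSE (ltn_ord i)) // => ->.
rewrite big1 // => i _; apply/eqP; rewrite eqb0; apply/negP.
by case/andP => /eqP eu /eqP ev; apply: ne; rewrite eu ev cat_take_drop.
Qed.

Lemma cfE f s : cf f s = \sum_(w <- msupp f) f@_w *+ ((w : seq _) == s).
Proof.
rewrite {1}/cf {1}[f]monalgE raddf_sum /=; apply: eq_bigr => w _.
by rewrite [LHS]mcoeffU.
Qed.

Lemma cfM f h s :
  cf (f * h) s =
    \sum_(i < (size s).+1) cf f (take i s) * cf h (drop i s).
Proof.
rewrite {1}/cf mcoeffMl; under [RHS]eq_bigr do rewrite !cfE mulr_suml.
rewrite [RHS]exchange_big; apply: eq_bigr => w _ /=.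
under [RHS]eq_bigr do rewrite mulr_sumr.
rewrite [RHS]exchange_big; apply: eq_bigr => x _ /=.
under [RHS]eq_bigr do rewrite mulrnAr mulrnAl -mulrnA mulnb.
rewrite sumrMnr -cat_eq_sum; congr (_ *+ _); congr nat_of_bool.
by rewrite -[LHS]val_eqE /= fmM.
Qed.

(** * The involution on words and on polynomials *)

Definition sstar s := rev (map (@letter_star g) s).

Lemma letter_starK : involutive (@letter_star g).
Proof. by case. Qed.

Lemma sstarK : involutive sstar.
Proof.
by move=> s; rewrite /sstar map_rev revK mapK //; apply: letter_starK.
Qed.

Lemma size_sstar s : size (sstar s) = size s.
Proof. by rewrite size_rev size_map. Qed.

Lemma cf_star f s : cf (star f) s = cf f (sstar s).
Proof.
rewrite cf_sum cfE; apply: eq_bigr => w _; rewrite /cf mcoeffU.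
congr (_ *+ _); congr nat_of_bool.
rewrite -[LHS]/(sstar w == s); apply/eqP/eqP => [<-|->]; by rewrite sstarK.
Qed.

Lemma starB f h : star (f - h) = star f - star h.
Proof. by apply: cfP => s; rewrite [LHS]cf_star [RHS]cfB cfB; congr (_ - _);
  rewrite cf_star. Qed.

Lemma starM f h : star (f * h) = star h * star f.
Proof.
apply: cfP => s; rewrite [LHS]cf_star [LHS]cfM [RHS]cfM size_sstar.
rewrite (reindex_inj rev_ord_inj) /=; apply: eq_bigr => i _; rewrite [LHS]mulrC.
have := ltn_ord i; rewrite ltnS subSS => le; congr (_ * _); rewrite cf_star.
  by rewrite /sstar drop_rev size_map subKn // map_take.
by rewrite /sstar take_rev size_map subKn // map_drop.
Qed.

(** * Strict degree bounds and top coefficients *)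

Definition deg_lt (n : nat) f := forall s, (n <= size s)%N -> cf f s = 0.

Lemma deg_ltS n f : deg_lt n f -> deg_lt n.+1 f.
Proof. by move=> d s lt; apply/d/ltnW. Qed.

Lemma deg_lt_eq0 f : deg_lt 0 f -> f = 0.
Proof. by move=> d; apply: cfP => s; rewrite cf0 d. Qed.

Lemma deg_ltD n f h : deg_lt n f -> deg_lt n h -> deg_lt n (f + h).
Proof. by move=> df dh s le; rewrite cfD df ?dh ?addr0. Qed.

Lemma deg_ltB n f h : deg_lt n f -> deg_lt n h -> deg_lt n (f - h).
Proof. by move=> df dh s le; rewrite cfB df ?dh ?subr0. Qed.

Lemma deg_ltM m n f h :
  deg_lt m.+1 f -> deg_lt n.+1 h -> deg_lt (m + n).+1 (f * h).
Proof.
move=> df dh s lt; rewrite cfM big1 // => i _.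
have le : (i <= size s)%N by rewrite -ltnS.
case: (ltnP m i) => [mi|im]; first by rewrite df ?mul0r // size_takel.
by rewrite [X in _ * X]dh ?mulr0 // size_drop ltn_subRL (leq_ltn_trans _ lt) ?leq_add2r.
Qed.

Lemma deg_lt_star n f : deg_lt n f -> deg_lt n (star f).
Proof. by move=> d s le; rewrite cf_star d // size_sstar. Qed.

(** Only the cut between [u] and [v] survives: any other cut makes one of the two pieces longer than
    its degree bound allows. *)
Lemma cfM_top m n f h u v :
  deg_lt m.+1 f -> deg_lt n.+1 h -> size u = m -> size v = n ->
  cf (f * h) (u ++ v) = cf f u * cf h v.
Proof.
move=> df dh su sv; rewrite cfM.
have lt : (size u < (size (u ++ v)).+1)%N by rewrite size_cat ltnS leq_addr.
rewrite (bigD1 (Ordinal lt)) //= take_size_cat // drop_size_cat //.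
rewrite big1 ?addr0 // => i ni.
have le : (i <= size (u ++ v))%N by rewrite -ltnS.
case: (ltnP m i) => [mi|im]; first by rewrite df ?mul0r // size_takel.
have lti : (i < m)%N.
  rewrite ltn_neqAle im andbT -su.
  by apply: contraNneq ni => e; apply/eqP/val_inj.
have suv : size (u ++ v) = (m + n)%N by rewrite size_cat su sv.
by rewrite [X in _ * X]dh ?mulr0 // size_drop ltn_subRL (leq_trans _ (eq_leq (esym suv))) // ltn_add2r.
Qed.

(** The right cofactor of the letter [y] in [f]. The empty word is sent to itself by [take], which
    is harmless since the coefficient there is still read off from [f]. *)
Definition rquo (y : letter g) f : ncpoly R g :=
  [malg w in [fset FMonom (take (size w).-1 w) | w : word g in msupp f]%fset =>
     cf f (rcons w y)].

Lemma cf_rquo y f s : cf (rquo y f) s = cf f (rcons s y).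
Proof.
rewrite cf_fsetE; case: ifPn => //= nin; apply/esym/eqP/negPn; apply: contra nin.
move=> nz; apply/imfsetP; exists (FMonom (rcons s y)); rewrite ?mem_msupp //=.
by rewrite size_rcons -cats1 take_size_cat.
Qed.

Lemma deg_lt_rquo n y f : deg_lt n.+1 f -> deg_lt n (rquo y f).
Proof. by move=> d s le; rewrite cf_rquo d // size_rcons. Qed.


Lemma degreeP f : deg_lt (degree f).+1 f.
Proof.
move=> s; rewrite ltnNge => /negP le; apply/eqP/negPn/negP => nz; apply: le.
by apply: (@leq_bigmax_seq _ _ _ (@fdeg _) (FMonom s)); rewrite // mem_msupp.
Qed.

Lemma deg_lt_pred n f :
  deg_lt n.+1 f -> (forall s, size s = n -> cf f s = 0) -> deg_lt n f.
Proof. by move=> d e s; rewrite leq_eqVlt => /predU1P[/esym/e|/d]. Qed.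

Lemma deg_ltZ n (k : R) f : deg_lt n f -> deg_lt n (k *: f).
Proof. by move=> d s le; rewrite cfZ d // mulr0. Qed.

(** Membership in [I + I^*] for the left ideal [I] generated by [p], since
    [star (q * p) = star p * star q]. *)
Definition in_sum p f := exists b c, f = b * p + star p * c.

Lemma syzygyE (A : pzRingType) (b c x y h : A) :
  b * x + y * c = (b + y * h) * x + y * (c - h * x).
Proof. by rewrite mulrDl mulrBr !mulrA addrACA subrr addr0. Qed.

(** Read with [x = p], [y = star p] and [sa], [sq] the stars of [a], [q]: reducing each [a i] modulo
    [p] keeps the sum of squares in [I + I^*]. *)
Lemma sum_syzygyE (A : pzRingType) r (a sa q sq : 'I_r -> A) (b c x y : A) :
  \sum_(i < r) sa i * a i = b * x + y * c ->
  \sum_(i < r) (sa i - y * sq i) * (a i - q i * x) =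
    (b - \sum_(i < r) (sa i - y * sq i) * q i) * x
      + y * (c - \sum_(i < r) sq i * a i).
Proof.
move=> e; rewrite mulrBl mulrBr addrACA -e mulr_suml mulr_sumr -opprD.
rewrite -big_split -sumrB; apply: eq_bigr => i _ /=.
by rewrite mulrBr mulrBl !mulrA opprD addrA [LHS]addrAC.
Qed.

(** * Affine generators with a nonzero coefficient at a letter [y] *)

Section Affine.
Variables (p : ncpoly R g) (y : letter g).
Hypotheses (p_affine : deg_lt 2 p) (py_neq0 : cf p [:: y] != 0).

Lemma cf_affine_ends n b c z1 z2 m :
  deg_lt n.+2 b -> deg_lt n.+2 c -> size m = n ->
  cf (b * p + star p * c) (letter_star z1 :: rcons m z2) =
    cf b (letter_star z1 :: m) * cf p [:: z2] + cf p [:: z1] * cf c (rcons m z2).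
Proof.
move=> db dc sm; rewrite cfD; congr (_ + _).
  by rewrite -rcons_cons -cats1 (cfM_top db p_affine) //= sm.
rewrite -cat1s (cfM_top (deg_lt_star p_affine) dc) ?size_rcons ?sm //.
by rewrite cf_star /sstar /= letter_starK.
Qed.

(* The top parts of b and c cancel in [b * p + star p * c] only through a common
   syzygy [(- star p * h, h * p)], which can be subtracted. *)
Lemma in_sum_deg_lt n f :
  deg_lt n.+2 f -> in_sum p f ->
  exists b c, [/\ deg_lt n.+1 b, deg_lt n.+1 c & f = b * p + star p * c].
Proof.
move=> df [b [c e]].
(* The excess [k] over the desired bound is removed one unit at a time. *)
have: exists k, deg_lt (n.+1 + k) b /\ deg_lt (n.+1 + k) c.
  exists (maxn (degree b).+1 (degree c).+1).
  split=> s le; apply: degreeP; apply: leq_trans le;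
    by rewrite (leq_trans _ (leq_addl _ _)) // leq_max leqnn ?orbT.
case=> k; elim: k => [|k IH] in b c e *; rewrite ?addn0.
  by case=> db dc; exists b, c.
rewrite addnS addSn => -[db dc].
(* This scaling makes [h * p] and [c] agree on top words ending in [y]; [cE] extends the agreement
   to all top words. *)
pose h : ncpoly R g := (cf p [:: y])^-1 *: rquo y c.
have dh : deg_lt (n + k).+1 h by apply/deg_ltZ/deg_lt_rquo.
have hE m : cf h m = cf c (rcons m y) / cf p [:: y].
  by rewrite cfZ cf_rquo mulrC.
(* These words are too long for [f]. Setting one end letter to [y] then expresses the top parts of
   [b] and [c] through [h]. *)
have rel z1 z2 m : size m = (n + k)%N ->
    cf b (letter_star z1 :: m) * cf p [:: z2] + cf p [:: z1] * cf c (rcons m z2) = 0.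
  move=> sm; rewrite -(cf_affine_ends _ _ db dc sm) -e df //= size_rcons sm.
  by rewrite !ltnS leq_addr.
have bE z m : size m = (n + k)%N -> cf b (z :: m) = - (cf p [:: letter_star z] * cf h m).
  move=> sm; have := rel (letter_star z) y m sm; rewrite letter_starK => r0.
  apply: (mulIf py_neq0); rewrite hE.
  by move/eqP: r0; rewrite addr_eq0 => /eqP ->; field.
have cE z m : size m = (n + k)%N -> cf c (rcons m z) = cf h m * cf p [:: z].
  move=> sm; have := rel y z m sm; rewrite bE // letter_starK => r0.
  apply: (mulfI py_neq0).
  by move/eqP: r0; rewrite mulNr addrC subr_eq0 => /eqP ->; ring.
apply: (IH (b + star p * h) (c - h * p)).
  by rewrite e; apply: syzygyE.
rewrite addSn; split; apply: deg_lt_pred.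
- by apply: deg_ltD => //; rewrite -add1n; exact: deg_ltM (deg_lt_star p_affine) dh.
- case=> [|z m] //= [sm]; rewrite cfD -cat1s (cfM_top (deg_lt_star p_affine) dh) //.
  by rewrite bE // [cf (star p) _]cf_star addNr.
- by apply: deg_ltB => //; rewrite -addn1; exact: deg_ltM dh p_affine.
- case/lastP=> [|m z] //; rewrite size_rcons => -[sm].
  by rewrite cfB cE // -cats1 (cfM_top dh p_affine) // subrr.
Qed.

(** The hypotheses give [c = - b], [d = a * b / x] and [e = - (a * b / x)], so the two terms
    cancel. *)
Lemma linear_relations (x a b c d e : R) :
  x != 0 -> b * x + x * c = 0 -> d * x + a * c = 0 -> b * a + x * e = 0 ->
  d * a + a * e = 0.
Proof.
move=> x0 e1 e2 e3; apply/(mulfI x0)/(mulfI x0).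
transitivity (x * a * (d * x + a * c) + x * a * (b * a + x * e)
  - a ^+ 2 * (b * x + x * c)); first by ring.
by rewrite e1 e2 e3; ring.
Qed.

Lemma sum_squares_cf_eq0 (r : nat) (a : 'I_r -> ncpoly R g) s :
  \sum_(i < r) cf (a i) s * cf (a i) s = 0 -> forall i, cf (a i) s = 0.
Proof.
move=> /eqP; rewrite psumr_eq0 => [|i _]; last by rewrite -expr2 sqr_ge0.
by move=> /allP al i; apply/eqP; rewrite -sqrf_eq0 expr2; exact: (al i (mem_index_enum i)).
Qed.

Lemma cf_sum_squares n (r : nat) (a : 'I_r -> ncpoly R g) u v :
  (forall i, deg_lt n.+1 (a i)) -> size u = n -> size v = n ->
  cf (\sum_(i < r) star (a i) * a i) (sstar u ++ v) =
    \sum_(i < r) cf (a i) u * cf (a i) v.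
Proof.
move=> da su sv; rewrite cf_sum; apply: eq_bigr => i _.
by rewrite (cfM_top (deg_lt_star (da i)) (da i)) ?size_sstar // cf_star sstarK.
Qed.

Lemma deg_lt_sum_squares n (r : nat) (a : 'I_r -> ncpoly R g) :
  (forall i, deg_lt n.+1 (a i)) ->
  deg_lt (n + n).+1 (\sum_(i < r) star (a i) * a i).
Proof.
move=> da s le; rewrite cf_sum big1 // => i _.
exact: (deg_ltM (deg_lt_star (da i)) (da i)).
Qed.

Lemma top_cf_eq0 n (r : nat) (a : 'I_r -> ncpoly R g) :
  (forall i, deg_lt n.+2 (a i)) ->
  (forall i w, size w = n -> cf (a i) (rcons w y) = 0) ->
  in_sum p (\sum_(i < r) star (a i) * a i) ->
  forall i, deg_lt n.+1 (a i).
Proof.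
move=> da ay ina i; apply: deg_lt_pred => //.
have [b [c [db dc e]]] : exists b c, [/\ deg_lt (n + n).+2 b, deg_lt (n + n).+2 c &
    \sum_(i < r) star (a i) * a i = b * p + star p * c].
  by apply: in_sum_deg_lt => //; rewrite -addnS -addSn; exact: deg_lt_sum_squares.
move=> s; case/lastP: s => [|w z] //; rewrite size_rcons => -[sw].
apply: sum_squares_cf_eq0.
(* With this middle part, [letter_star z1 :: rcons m z2] is the star of [rcons w z1] followed by
   [rcons w z2]. *)
set m := sstar w ++ w.
have sm : size m = (n + n)%N by rewrite size_cat size_sstar sw.
have E z1 z2 : \sum_(i < r) cf (a i) (rcons w z1) * cf (a i) (rcons w z2) =
    cf b (letter_star z1 :: m) * cf p [:: z2] + cf p [:: z1] * cf c (rcons m z2).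
  rewrite -(cf_affine_ends _ _ db dc sm) -e.
  rewrite -(cf_sum_squares da) ?size_rcons ?sw //.
  by rewrite /sstar map_rcons rev_rcons /= rcons_cat.
(* The three relations are the cases where an end letter is [y]; there [ay] kills every product in
   the sum. *)
rewrite E; apply: (linear_relations py_neq0 (b := cf b (letter_star y :: m))
   (c := cf c (rcons m y))); rewrite -E; apply: big1 => j _; rewrite ay ?mul0r ?mulr0 //.
Qed.

(** The first hypothesis rules out the excluded form in terms of coefficients: a skew linear part
    leaves no constant term. *)
Lemma const_cf_eq0 (r : nat) (a : 'I_r -> ncpoly R g) :
  ((forall z, cf p [:: z] = - cf p [:: letter_star z]) -> cf p [::] = 0) ->
  (forall i, deg_lt 1 (a i)) ->
  in_sum p (\sum_(i < r) star (a i) * a i) ->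
  forall i, a i = 0.
Proof.
move=> skew da ina i; apply/deg_lt_eq0/deg_lt_pred => // s /size0nil ->.
apply: sum_squares_cf_eq0; move: i => _.
have dF := deg_lt_sum_squares da.
(* The bound is weakened to [deg_lt 2], the smallest that [in_sum_deg_lt] accepts; it makes [b] and
   [c] constants. *)
have [b [c [db dc e]]] := in_sum_deg_lt (deg_ltS dF) ina.
have F0 : cf (b * p + star p * c) [::] = (cf b [::] + cf c [::]) * cf p [::].
  rewrite cfD mulrDl; congr (_ + _); rewrite cfM big_ord1 //=.
  by rewrite cf_star mulrC.
have rel z : cf b [::] * cf p [:: z] + cf p [:: letter_star z] * cf c [::] = 0.
  rewrite -[RHS](dF [:: z] isT) e cfD; congr (_ + _).
    exact/esym/(cfM_top (u := [::]) (v := [:: z]) db p_affine).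
  have := cfM_top (u := [:: z]) (v := [::]) (deg_lt_star p_affine) dc erefl erefl.
  by rewrite cf_star => <-.
have := cf_sum_squares (u := [::]) (v := [::]) da erefl erefl.
rewrite e F0 => <-.
have [bc|nbc] := eqVneq (cf b [::] + cf c [::]) 0.
  by rewrite bc mul0r.
(* The relations at [z] and at [letter_star z] add up to a multiple of [cf b [::] + cf c [::]],
   which can be cancelled. *)
rewrite skew ?mulr0 // => z; apply/eqP; rewrite -addr_eq0.
apply/eqP/(mulfI nbc); have := rel (letter_star z); rewrite letter_starK => rel'.
by rewrite mulr0 -[RHS](addr0 0) -{1}(rel z) -rel'; ring.
Qed.

Lemma affine_real n (r : nat) (a : 'I_r -> ncpoly R g) :
  ((forall z, cf p [:: z] = - cf p [:: letter_star z]) -> cf p [::] = 0) ->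
  (forall i, deg_lt n (a i)) ->
  in_sum p (\sum_(i < r) star (a i) * a i) ->
  forall i, exists q, a i = q * p.
Proof.
move=> skew; elim: n => [|[|n] IH] in a *.
- by move=> da _ i; exists 0; rewrite mul0r; apply: deg_lt_eq0.
- by move=> da ina i; exists 0; rewrite mul0r (const_cf_eq0 skew da ina).
move=> da [b [c e]] i.
(* Chosen so that [q i * p] and [a i] have the same coefficients at the top words ending in [y]. *)
pose q i : ncpoly R g := (cf p [:: y])^-1 *: rquo y (a i).
have dq j : deg_lt n.+1 (q j) by apply/deg_ltZ/deg_lt_rquo.
pose a' i := a i - q i * p.
have da' j : deg_lt n.+2 (a' j).
  by apply: deg_ltB => //; rewrite -addn1; exact: deg_ltM (dq j) p_affine.
have ina' : in_sum p (\sum_(i < r) star (a' i) * a' i).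
  exists (b - \sum_(i < r) (star (a i) - star p * star (q i)) * q i).
  exists (c - \sum_(i < r) star (q i) * a i); rewrite -(sum_syzygyE _ _ e).
  by apply: eq_bigr => j _; rewrite [star (a' j)]starB [star (q j * p)]starM.
have [q' e'] : exists q', a' i = q' * p.
  apply: IH (ina') i; apply: top_cf_eq0 => // j w sw.
  rewrite cfB -[in X in _ - X]cats1 (cfM_top (dq j) p_affine) // cfZ cf_rquo.
  by rewrite mulrAC mulVf // mul1r subrr.
by exists (q' + q i); rewrite mulrDl -e' subrK.
Qed.

(** A top word [w] of [q] would give the nonconstant word [rcons w y] in [q * p], with a nonzero
    coefficient. *)
Lemma mul_affine_const_eq0 q : deg_lt 1 (q * p) -> q = 0.
Proof.
move=> dqp; apply: deg_lt_eq0; move: (@degreeP q).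
elim: (degree q).+1 => // n IH dq; apply/IH/deg_lt_pred => // w sw.
apply: (mulIf py_neq0); rewrite mul0r -(cfM_top dq p_affine sw (v := [:: y])) //.
by rewrite dqp // size_cat addn1.
Qed.

End Affine.

(** * Generators of degree one with skew linear part *)

Definition analytic_part p : ncpoly R g :=
  [malg w in msupp p => if (w : seq _) is [:: inl _] then cf p w else 0].

Lemma cf_analytic_part p s :
  cf (analytic_part p) s = if s is [:: inl _] then cf p s else 0.
Proof.
rewrite cf_fsetE mem_msupp /=; case: eqVneq => //= e.
by case: s e => [|[i|i] [|z s]] //= ->.
Qed.

Lemma degree1_neq0 p : degree p = 1%N -> exists y, cf p [:: y] != 0.
Proof.
case: (boolP (has (fun w : word g => fdeg w == 1%N) (msupp p))).
  case/hasP => -[[|y [|z s]]] //; rewrite mem_msupp => nz _ _.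
  by exists y.
move=> /hasPn no dp; have d2 := @degreeP p; rewrite dp in d2.
suff : (degree p <= 0)%N by rewrite dp.
apply/bigmax_leqP_seq => -[s] ins _; have := no _ ins; move: ins.
rewrite mem_msupp /= /fdeg /=; case: (ltnP 1 (size s)) => [lt|].
  by rewrite d2 ?eqxx.
by case: (size s) => [|[]].
Qed.

Lemma skew_decomposition p : degree p = 1%N ->
  (forall z, cf p [:: z] = - cf p [:: letter_star z]) ->
  let a := analytic_part p in
  [/\ analytic a, homogeneous a, degree a = 1%N &
      p = a - star a + (cf p [::])%:MP].
Proof.
move=> dp skew a.
have suppE (w : word g) : w \in msupp a -> exists i, w = FMonom [:: inl i].
  rewrite mem_msupp cf_analytic_part.
  by case: w => -[|[i|i] [|z s]] /=; rewrite ?eqxx // => _; exists i.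
have p_affine := @degreeP p; rewrite dp in p_affine.
split.
- by move=> w /suppE[i ->] j; rewrite inE.
- by move=> u v /suppE[i ->] /suppE[j ->].
- apply/eqP; rewrite eqn_leq; apply/andP; split.
    by apply/bigmax_leqP_seq => w /suppE[i ->].
  have [y py] := degree1_neq0 dp.
  (* Skewness carries a nonzero coefficient at a starred letter over to the unstarred one. *)
  have [i pi] : exists i, cf p [:: inl i] != 0.
    case: y py => i pi; exists i => //.
    by move: pi; rewrite skew oppr_eq0.
  apply: (@leq_bigmax_seq _ _ _ (@fdeg _) (FMonom [:: inl i])) => //.
  by rewrite mem_msupp cf_analytic_part.
apply: cfP => s; rewrite cfD cfC cfB cf_star !cf_analytic_part.
case: s => [|z [|z' s]] /=; rewrite ?subr0 ?add0r ?addr0 //.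
  by case: z => i /=; rewrite ?subr0 // sub0r skew.
rewrite p_affine //; have : (1 < size (sstar [:: z, z' & s]))%N by rewrite size_sstar.
by case: (sstar _) => [|[?|?] [|? ?]] //=; rewrite ?subr0; case: (z).
Qed.

Lemma star_const (k : R) : star (k%:MP : ncpoly R g) = k%:MP.
Proof.
by apply: cfP => s; rewrite cf_star !cfC -!size_eq0 size_sstar.
Qed.

End Coefficients.

Theorem corollary3p22 (R : realType) (g : nat) (p : ncpoly R g)
    (hp : degree p = 1%N) :
  real_ideal (left_ideal_gen p) <->
  ~ exists (a : ncpoly R g) (c : R),
      [/\ analytic a, homogeneous a, degree a = 1%N, c != 0 &
          p = a - star a + c%:MP].
Proof.
have p_affine := @degreeP _ _ p; rewrite hp in p_affine.
have [y py] := degree1_neq0 hp.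
split=> [real_p [a [c [_ _ _ c0 pE]]]|nskew r a].
  (* As [p + star p] is the constant [c *+ 2], multiplying [p] by the sign of [c] makes the sum
     nonnegative, hence the square of the constant [s]. *)
  pose s : ncpoly R g := (Num.sqrt `|c *+ 2|)%:MP.
  have: left_ideal_gen p s.
    apply: (real_p 1%N (fun=> s) _ ord0).
    pose e : ncpoly R g := (Num.sg c)%:MP.
    exists (e * p); first by exists e.
    exists (star (e * p)); first by exists (e * p) => //; exists e.
    rewrite big_ord1; apply: cfP => t.
    rewrite cfD cf_star mul_malgC !cfZ star_const mul_malgC cfZ.
    rewrite {1 2}pE !cfD !cfN !cf_star sstarK !cfC.
    have -> : (sstar t == [::]) = (t == [::]) by rewrite -!size_eq0 size_sstar.
    rewrite mulrnAr -expr2 sqr_sqrtr // normrMn normrEsg.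
    by case: (t == [::]); rewrite /= ?mulr1n ?mulr0n; ring.
  case=> q _ qE.
  have q0 : q = 0.
    apply: (mul_affine_const_eq0 p_affine py); rewrite qE => -[|z t] // _.
    by rewrite cfC.
  have := cfC (g := g) (Num.sqrt `|c *+ 2|) [::].
  rewrite -/s -qE q0 mul0r cf0 mulr1n => /esym/eqP.
  by rewrite sqrtr_eq0 normr_le0 mulrn_eq0 (negPf c0).
case=> _ [b _ <-] [_ [_ [c _ <-] <-] e] i.
suff [q ->] : exists q, a i = q * p by exists q.
apply: (affine_real (n := (\max_(i < r) (degree (a i)).+1)%N) p_affine py) => //.
- move=> skew; apply/eqP/negPn/negP => c0; apply: nskew.
  have [? ? ? pE] := skew_decomposition hp skew.
  by exists (analytic_part p), (cf p [::]).
- move=> j s le; apply: degreeP; apply: leq_trans le.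
  exact: (leq_bigmax (F := fun i => (degree (a i)).+1) j).
- by exists b, (star c); rewrite -e starM.
Qed.
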